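(* Let $X$ be a Banach space, $Y=\mathbb{R}^k$ $(k\ge1)$, $Z=\mathbb{R}^p$ $(p\ge1)$, $Q=\mathbb{R}_+^m\times\{0\}^n$ with $m+n=p$, $K\subset Y$ a proper convex cone with $\operatorname{int}K\neq\emptyset$, $L\subset S_X$ a nonempty closed set with $\operatorname{cone}L$ convex, and $f:X\to Y$, $g:X\to Z$ Fréchet differentiable. Denote by $\mu_1,\dots,\mu_m$ the first $m$ coordinate functions of $g$ and by $\nu_1,\dots,\nu_n$ the next $n$ coordinate functions of $g$. Suppose that $f$ is $K$-convex, $\mu_i$, $i\in\{1,\dots,m\}$, are convex and $\nu_j$, $j\in\{1,\dots,n\}$, are affine. Let $\overline{x}\in g^{-1}(-Q)$. If there exist $(\lambda,\tau)\in\mathbb{R}_+^m\times\mathbb{R}^n$ and $y^*\in K^+\setminus\{0\}$ such that $$0\in y^*\circ\nabla f(\overline{x})+\sum_{i=1}^m\lambda_i\nabla\mu_i(\overline{x})+\sum_{j=1}^n\tau_j\nabla\nu_j(\overline{x})+L^-$$ and $$\lambda_i\mu_i(\overline{x})=0,\quad\forall i\in\{1,\dots,m\},$$ then $\overline{x}$ is a global weak directional Pareto minimum point for $f$ on $g^{-1}(-Q)$ with respect to $L$.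
   Context: $S_X$ is the unit sphere of $X$; $\operatorname{cone}C=\{tc\mid t\ge0,\ c\in C\}$. A convex cone $K$ is proper if $K\neq\{0\}$ and $K\neq Y$ (not necessarily pointed). $K^+=\{y^*\in Y^*\mid y^*(y)\ge0\ \forall y\in K\}$ and $L^-=\{x^*\in X^*\mid x^*(\ell)\le0\ \forall\ell\in L\}$. $\nabla$ denotes the Fréchet derivative. $f$ is $K$-convex if for all $\lambda\in(0,1)$ and $x,y\in X$, $\lambda f(x)+(1-\lambda)f(y)\in f(\lambda x+(1-\lambda)y)+K$. Global weak directional Pareto minimum: with $A=g^{-1}(-Q)$, $\overline{x}\in A$ is a global weak directional Pareto minimum point for $f$ on $A$ with respect to $L$ if $f(x)-f(\overline{x})\notin-\operatorname{int}K$ for all $x\in A\cap(\overline{x}+\operatorname{cone}L)$. *)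

(* Defs.v *)
From HB Require Import structures.
From mathcomp Require Import all_boot all_order all_algebra.
From mathcomp Require Import boolp classical_sets functions reals.
From mathcomp Require Import topology normedtype convex landau derive.

Set Implicit Arguments.
Unset Strict Implicit.
Unset Printing Implicit Defensive.

Import Order.TTheory GRing.Theory Num.Theory.
Import numFieldNormedType.Exports.

Local Open Scope classical_set_scope.
Local Open Scope ring_scope.

Definition unit_sphere (R : realType) (V : normedModType R) : set V :=
  [set x | `|x| = 1].

Definition cone (R : realType) (V : lmodType R) (C : set V) : set V :=
  [set t *: c | t in [set t : R | 0 <= t] & c in C].

Definition is_cone (R : realType) (V : lmodType R) (K : set V) : Prop :=
  forall (t : R) (x : V), 0 <= t -> K x -> K (t *: x).

(* Pointedness (K `&` - K = {0}) is not required. *)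
Definition proper_convex_cone (R : realType) (V : lmodType R) (K : set V) :
    Prop :=
  [/\ is_cone K, convex_set (K : set (convex_lmodType V)),
      K <> [set 0] & K <> setT].

(* The topological dual, carried by plain functions so that functionals can be
   added and compared pointwise. *)
Definition dual (R : realType) (V : normedModType R) : set (V -> R^o) :=
  [set u | linear u /\ continuous u].

Definition pos_dual (R : realType) (V : normedModType R) (K : set V) :
    set (V -> R^o) :=
  dual (V:=V) `&` [set u | forall y, K y -> 0 <= u y].

Definition neg_dual (R : realType) (V : normedModType R) (L : set V) :
    set (V -> R^o) :=
  dual (V:=V) `&` [set u | forall l, L l -> u l <= 0].

Definition K_convex (R : realType) (V W : lmodType R) (K : set W)
    (f : V -> W) : Prop :=
  forall (t : R) (x y : V), 0 < t < 1 ->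
    [set f (t *: x + (1 - t) *: y) + k | k in K] (t *: f x + (1 - t) *: f y).

Definition affine_function (R : realType) (V W : lmodType R) (f : V -> W) :
    Prop :=
  forall (t : R) (x y : V),
    f (t *: x + (1 - t) *: y) = t *: f x + (1 - t) *: f y.

(* R_+^m x {0}^n inside R^(m + n). *)
Definition orthant (R : realType) (m n : nat) : set 'rV[R]_(m + n) :=
  [set z | (forall i : 'I_m, 0 <= z ord0 (lshift n i)) /\
           (forall j : 'I_n, z ord0 (rshift m j) = 0)].

Definition feasible (R : realType) (X : Type) (m n : nat)
    (g : X -> 'rV[R]_(m + n)) : set X :=
  g @^-1` [set - q | q in @orthant R m n].

Definition mu (R : realType) (X : Type) (m n : nat)
    (g : X -> 'rV[R]_(m + n)) (i : 'I_m) : X -> R^o :=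
  fun x => g x ord0 (lshift n i).

Definition nu (R : realType) (X : Type) (m n : nat)
    (g : X -> 'rV[R]_(m + n)) (j : 'I_n) : X -> R^o :=
  fun x => g x ord0 (rshift m j).

Definition global_weak_dir_Pareto_min (R : realType) (X W : normedModType R)
    (K : set W) (L : set X) (f : X -> W) (A : set X) (xbar : X) : Prop :=
  A xbar /\
  forall x, (A `&` [set xbar + d | d in cone L]) x ->
    ~ [set - k | k in interior K] (f x - f xbar).

(* Main.v *)
(* A function convex along the segment from xbar to x and differentiable at xbar
   lies above its linearization there.  Apply this with d := x - xbar, a
   nonnegative multiple of an element of L, to ystar o f and to the mu_i: the
   multiplier rule evaluated at d, with complementary slackness and feasibility
   of x, gives ystar (f x - f xbar) >= 0.  A nonzero element of K^+ is positive
   on the interior of K, so f x - f xbar is not in - int K. *)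
Require Import Defs.
From HB Require Import structures.
From mathcomp Require Import all_boot all_order all_algebra.
From mathcomp Require Import boolp classical_sets functions reals.
From mathcomp Require Import topology normedtype convex landau derive.
From mathcomp Require Import interval_inference lra.

Set Implicit Arguments.
Unset Strict Implicit.
Unset Printing Implicit Defensive.

Import Order.TTheory GRing.Theory Num.Theory.
Import numFieldNormedType.Exports.

Local Open Scope classical_set_scope.
Local Open Scope ring_scope.

(** The derivative along [x - a] is the limit of the difference quotients with step [h], and for
    [0 < h < 1] convexity bounds each quotient by [F x - F a]. Convexity is asked only on the
    segment, in the form that [y \o f] and [mu g i] both provide. *)
Lemma diff_le_of_convex (R : realType) (V : normedModType R) (F : V -> R^o)
    (a x : V) :
  differentiable F a ->
  (forall t : R, 0 < t < 1 ->
    F (t *: x + (1 - t) *: a) <= t * F x + (1 - t) * F a) ->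
  'd F a (x - a) <= F x - F a.
Proof.
move=> dF cF; rewrite -deriveE //.
have /cvg_ex[l Dl] : derivable F a (x - a) by exact: diff_derivable.
rewrite /derive (cvg_lim _ Dl) //.
(* Restrict the limit over [h != 0] to [h > 0], where clearing the factor [h^-1] preserves
   inequalities. *)
have Dr : (fun h : R => h^-1 *: ((F \o shift a) (h *: (x - a)) - F a))
    @ 0^'+ --> l.
  apply: cvg_trans Dl; apply: cvg_app.
  move=> A [e egt0 Ae]; exists e => // y ye y0; apply: Ae => //.
  exact/lt0r_neq0.
rewrite -(cvg_lim _ Dr) //; apply: limr_le; first by apply/cvg_ex; exists l.
near=> h.
have h0 : 0 < h by near: h; exact: nbhs_right_gt.
have h1 : h < 1 by near: h; exact: nbhs_right_lt.
have E : h *: (x - a) + a = h *: x + (1 - h) *: a.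
  by rewrite scalerBr scalerBl scale1r -addrA (addrC (- _)).
rewrite /= E /GRing.scale /= mulrC ler_pdivrMr //.
have := cF h; rewrite h0 h1 => /(_ isT); lra.
Unshelve. all: by end_near.
Qed.

(** Both [F] and [- F] are convex, so the linearization bound holds in both directions. *)
Lemma diff_eq_of_affine (R : realType) (V : normedModType R) (F : V -> R^o)
    (a x : V) :
  differentiable F a -> affine_function F -> 'd F a (x - a) = F x - F a.
Proof.
move=> dF aF; apply/eqP; rewrite eq_le; apply/andP; split.
  by apply: diff_le_of_convex => // t _; rewrite aF.
have cNF (t : R) : 0 < t < 1 ->
    (- F) (t *: x + (1 - t) *: a) <= t * (- F) x + (1 - t) * (- F) a.
  by move=> _; rewrite !fctE aF opprD -!scalerN.
have := diff_le_of_convex (differentiableN dF) cNF.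
by rewrite diffN // !fctE -opprD lerN2.
Qed.

Lemma pos_functional_gt0 (R : realType) (W : normedModType R) (K : set W)
    (u : W -> R^o) (y : W) :
  pos_dual K u -> u <> 0 -> interior K y -> 0 < u y.
Proof.
move=> [[lu _] uK] u0 Ky.
(* Moving from y against w := u v *: v, where u w = (u v)^2 > 0, stays in K for
   a short while and strictly decreases u. *)
have [v uv] : exists v, u v <> 0.
  apply: contrapT => /forallNP u_eq0; apply: u0; apply/funext => v.
  exact: contrapT (u_eq0 v).
pose L : {linear W -> R^o} := HB.pack u (GRing.isLinear.Build _ _ _ _ u lu).
have uZ (e : R) z : u (e *: z) = e * u z by exact: (linearZ_LR L).
have uB z z' : u (z - z') = u z - u z' by exact: (linearB L).
pose w := (u v : R) *: v.
have uw : 0 < u w.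
  by rewrite uZ -expr2 exprn_even_gt0 //; exact/eqP.
have c : (fun e : R => y - e *: w) @ (0 : R)^'+ --> y.
  apply: cvg_at_right_filter; rewrite -[X in _ --> X]subr0 -(scale0r w).
  apply: cvgB; first exact: cvg_cst.
  by apply: cvgZr_tmp; exact: cvg_id.
have : \forall e \near (0 : R)^'+, K (y - e *: w) by exact: c.
move=> cK; near (0 : R)^'+ => e.
have e0 : 0 < e by near: e; exact: nbhs_right_gt.
have /uK : K (y - e *: w) by near: e.
rewrite uB uZ subr_ge0; apply: lt_le_trans.
exact: mulr_gt0.
Unshelve. all: by end_near.
Qed.

Theorem proposition3p15 (R : realType) (X : completeNormedModType R)
    (k m n : nat) (hk : (1 <= k)%N) (hp : (1 <= m + n)%N)
    (K : set 'rV[R]_k) (hK : proper_convex_cone K) (hintK : interior K !=set0)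
    (L : set X) (hLS : L `<=` @unit_sphere R X) (hL0 : L !=set0)
    (hLcl : closed L) (hLconv : convex_set (cone L : set (convex_lmodType X)))
    (f : X -> 'rV[R]_k) (hf : forall x, differentiable f x)
    (g : X -> 'rV[R]_(m + n)) (hg : forall x, differentiable g x)
    (hfK : K_convex K f)
    (hmu : forall i : 'I_m, @convex_function R X setT (mu g i))
    (hnu : forall j : 'I_n, affine_function (nu g j))
    (xbar : X) (hxbar : feasible g xbar)
    (hKKT : exists (lambda : 'rV[R]_m) (tau : 'rV[R]_n)
                   (ystar : 'rV[R]_k -> R^o),
      [/\ forall i : 'I_m, 0 <= lambda ord0 i,
          (pos_dual K `\` [set 0]) ystar,
          [set (ystar \o 'd f xbar)
               + \sum_(i < m) lambda ord0 i *: ('d (mu g i) xbar : X -> R^o)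
               + \sum_(j < n) tau ord0 j *: ('d (nu g j) xbar : X -> R^o)
               + u | u in neg_dual L] 0
        & forall i : 'I_m, lambda ord0 i * mu g i xbar = 0]) :
  global_weak_dir_Pareto_min K L f (feasible g) xbar.
Proof.
have [lambda [tau [y [lam0 [posy /= y0] [u [[lu _] uL]] E comp]]]] := hKKT.
split=> // x [[q [qge0 qeq0] gxE] /= [d [t /= t0 [l Ll tlE]] xE]] [v Kv vE].
have dE : d = x - xbar by rewrite -xE addrAC subrr add0r.
have [[ly cy] yK] := posy.
pose Y : {linear 'rV[R]_k -> R^o} :=
  HB.pack y (GRing.isLinear.Build _ _ _ _ y ly).
have yD z z' : y (z + z') = y z + y z' by exact: (linearD Y).
have yZ (s : R) z : y (s *: z) = s * y z by exact: (linearZ_LR Y).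
have yB z z' : y (z - z') = y z - y z' by exact: (linearB Y).
have yN z : y (- z) = - y z by exact: (linearN Y).
have ud : u d <= 0.
  pose U : {linear X -> R^o} := HB.pack u (GRing.isLinear.Build _ _ _ _ u lu).
  have uZ (s : R) z : u (s *: z) = s * u z by exact: (linearZ_LR U).
  by rewrite -tlE uZ mulr_ge0_le0 // uL.
(* Since [y] is nonnegative on [K], [K]-convexity of [f] makes [y \o f] convex; the chain rule
   identifies its differential. *)
have fd : y ('d f xbar d) <= y (f x - f xbar).
  have dY z : differentiable Y z by exact: linear_differentiable.
  have dYf : 'd (Y \o f) xbar = Y \o 'd f xbar :> (X -> R^o).
    by rewrite diff_comp // diff_lin.
  have -> : y ('d f xbar d) = 'd (Y \o f) xbar d by rewrite dYf.
  rewrite dE yB; apply: diff_le_of_convex.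
    exact: differentiable_comp.
  move=> s s01; have [c Kc cE] := hfK s x xbar s01.
  by rewrite /= -!yZ -yD -cE yD lerDl yK.
have dmu i : differentiable (mu g i) xbar.
  exact: (@differentiable_comp _ _ _ _ g (fun z => z ord0 (lshift n i) : R^o)
    _ (hg xbar) (differentiable_coord _ _ _)).
have dnu j : differentiable (nu g j) xbar.
  exact: (@differentiable_comp _ _ _ _ g (fun z => z ord0 (rshift m j) : R^o)
    _ (hg xbar) (differentiable_coord _ _ _)).
(* By complementary slackness the convexity bound reduces to [lambda ord0 i * mu g i x], which is
   nonpositive by feasibility of [x]. *)
have mud i : lambda ord0 i * 'd (mu g i) xbar d <= 0.
  have mux : mu g i x <= 0 by rewrite /mu -gxE mxE oppr_le0.
  apply: (@le_trans _ _ (lambda ord0 i * (mu g i x - mu g i xbar))).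
    apply: ler_wpM2l; first exact: lam0.
    rewrite dE; apply: diff_le_of_convex => // s /andP[s0 s1].
    by have := hmu i (Itv01 (ltW s0) (ltW s1)) x xbar (in_setT _) (in_setT _).
  by rewrite mulrBr comp subr0 mulr_ge0_le0.
(* [nu g j] vanishes at both feasible points [x] and [xbar]. *)
have nud j : 'd (nu g j) xbar d = 0.
  have [q' [_ q'0] gxbarE] := hxbar.
  rewrite dE diff_eq_of_affine // /nu -gxE -gxbarE !mxE qeq0 q'0.
  by rewrite oppr0 subrr.
have := congr1 (fun h : X -> R^o => h d) E.
rewrite /= !fctE !fct_sumE => Ed.
have v0 := pos_functional_gt0 posy y0 Kv.
have lam_sum :
    \sum_(i < m) (lambda ord0 i *: ('d (mu g i) xbar : X -> R^o)) d <= 0.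
  by apply: sumr_le0 => i _; exact: mud.
have tau_sum :
    \sum_(j < n) (tau ord0 j *: ('d (nu g j) xbar : X -> R^o)) d = 0.
  apply: big1 => j _; have := congr1 (fun r => tau ord0 j * r) (nud j).
  by rewrite mulr0.
have yv : y (f x - f xbar) = - y v by rewrite -vE yN.
have {}Ed : y ('d f xbar d)
    + \sum_(i < m) (lambda ord0 i *: ('d (mu g i) xbar : X -> R^o)) d + u d = 0.
  by rewrite -[RHS]Ed tau_sum addr0.
(* The first term of [Ed] is at most [- y v < 0] and the other two are nonpositive, so their sum
   cannot be zero. *)
move: fd; rewrite yv; lra.
Qed.
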